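(* A finite left nilpotent algebra has a Maltsev polynomial if and only if it has a pointed cube polynomial.
   Context: An algebra $\mathbf{A}$ is left nilpotent if $[1_{\mathbf A},\dots,[1_{\mathbf A},[1_{\mathbf A},1_{\mathbf A}]]\dots]=0_{\mathbf A}$ for a sufficiently long expression, using the term condition commutator. A Maltsev polynomial is a polynomial $m$ with $m(x,y,y)=x=m(y,y,x)$. A term $F(x_1,\dots,x_m)$ is a $p$-pointed $k$-cube term if there is a $k\times m$ matrix $M$ of variables and $p$ distinct constant symbols, every column containing a symbol different from the variable $x$, with $F(M)\approx(x,\dots,x)^T$ (row-wise); a pointed cube polynomial of $\mathbf{A}$ is a pointed cube term of the expansion of $\mathbf{A}$ by all constants. *)

(* Defs.v *)
From mathcomp Require Import all_boot.
Set Implicit Arguments. Unset Strict Implicit. Unset Printing Implicit Defensive.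

Section UA.
Variables (O : Type) (ar : O -> nat) (A : finType)
          (op : forall f : O, ('I_(ar f) -> A) -> A).

Inductive term (K V : Type) : Type :=
  | Var of V
  | Cst of K
  | App (f : O) of ('I_(ar f) -> term K V).

Fixpoint eval (K V : Type) (k : K -> A) (s : V -> A) (t : term K V) : A :=
  match t with
  | Var v => s v
  | Cst c => k c
  | App f args => op (fun i => eval k s (args i))
  end.

Definition pterm (V : Type) := term Empty_set V.
Definition peval (V : Type) (s : V -> A) (t : pterm V) : A :=
  eval (fun e : Empty_set => match e with end) s t.

Definition poly (V : Type) := term A V.
Definition poleval (V : Type) (s : V -> A) (t : poly V) : A := eval id s t.

Definition congruence (R : A -> A -> Prop) : Prop :=
  (forall x, R x x) /\ (forall x y, R x y -> R y x) /\
  (forall x y z, R x y -> R y z -> R x z) /\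
  (forall f (a b : 'I_(ar f) -> A), (forall i, R (a i) (b i)) -> R (op a) (op b)).

Definition centralizes (alpha beta delta : A -> A -> Prop) : Prop :=
  forall (m n : nat) (t : pterm ('I_m + 'I_n)) (a b : 'I_m -> A) (c d : 'I_n -> A),
    (forall i, alpha (a i) (b i)) -> (forall j, beta (c j) (d j)) ->
    delta (peval (fun v => match v with inl i => a i | inr j => c j end) t)
          (peval (fun v => match v with inl i => a i | inr j => d j end) t) ->
    delta (peval (fun v => match v with inl i => b i | inr j => c j end) t)
          (peval (fun v => match v with inl i => b i | inr j => d j end) t).

Definition commutator (alpha beta : A -> A -> Prop) : A -> A -> Prop :=
  fun x y => forall delta, congruence delta -> centralizes alpha beta delta -> delta x y.

Definition cong1 : A -> A -> Prop := fun _ _ => True.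
Definition cong0 : A -> A -> Prop := fun x y => x = y.

Fixpoint left_series (n : nat) : A -> A -> Prop :=
  match n with
  | 0 => cong1
  | S n' => commutator cong1 (left_series n')
  end.

Definition left_nilpotent : Prop :=
  exists n, forall x y, left_series n x y -> cong0 x y.

Definition has_maltsev_poly : Prop :=
  exists m : poly 'I_3, forall x y : A,
    poleval (fun i : 'I_3 => nth x [:: x; y; y] i) m = x /\
    poleval (fun i : 'I_3 => nth x [:: y; y; x] i) m = x.

(* F is a p-pointed k-cube polynomial witnessed by the k x m matrix M whose
   entries are variables (inl v, v : nat; the variable x is inl 0) or one of
   the p distinct constants c q (inr q). *)
Definition pointed_cube_poly (p k m : nat) (c : 'I_p -> A) (F : poly 'I_m)
    (M : 'I_k -> 'I_m -> (nat + 'I_p)) : Prop :=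
  injective c /\
  (forall j : 'I_m, exists i : 'I_k, M i j <> inl 0) /\
  (forall (i : 'I_k) (s : nat -> A),
     poleval (fun j => match M i j with inl v => s v | inr q => c q end) F = s 0).

Definition has_pointed_cube_poly : Prop :=
  exists (p k m : nat) (c : 'I_p -> A) (F : poly 'I_m) (M : 'I_k -> 'I_m -> (nat + 'I_p)),
    0 < k /\ 0 < m /\ pointed_cube_poly c F M.

End UA.

(* Main.v *)
(* Let 1 = L_0, L_(i+1) = [1, L_i] be the left central series, ending at 0, and
   let N = |A|!, so that the N-th iterate of every self-map of A is idempotent.
   If f(u, -) is injective for some u, then pairs identified by f(u', -) descend
   along the series, so f(u', -) is injective as well.  Hence in a pointed cube
   polynomial F all constants may be replaced by one element z: for every row,
   with S the set of positions of x, F(x on S, z elsewhere) is a permutation.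

   By induction on the number of rows such an F yields a binary polynomial all
   of whose translations are permutations; the same is proved on the range of
   any idempotent polynomial e in place of A.  Iterating F in itself turns all
   the row permutations into identities.  Merge the first two rows S0, S1 into
   their intersection, let K(x, y, w) be F with x on S0 n S1, y on S0 \ S1,
   w on S1 \ S0 and z elsewhere, and let G be K iterated N times in x, so that
   G(x, x, z) = x = G(x, z, x) and e' = G(-, z, z) is idempotent.  The induction
   hypothesis on the range of e' gives Q', and G(Q'(e' x, e' y), x, y) is the
   required polynomial: Q' separates the pairs separated by e', and the last two
   arguments of G separate those which e' identifies.

   Finally a finite quasigroup polynomial provides the Maltsev polynomial
   (x / (y \ y)) (y \ w). *)

From Stdlib Require Import FunctionalExtensionality.
Require Import Defs.
From mathcomp Require Import all_boot.

Set Implicit Arguments. Unset Strict Implicit. Unset Printing Implicit Defensive.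

(** * Iterates of self-maps of finite sets *)

(** By pigeonhole an orbit has preperiod and period at most [#|T|]; the period then divides the
    factorial. *)
Lemma iter_fact_idem (T : finType) (f : T -> T) (x : T) :
  iter #|T|`! f (iter #|T|`! f x) = iter #|T|`! f x.
Proof.
have [i [j [ltij lejT eqij]]] :
    exists i j, [/\ i < j, j <= #|T| & iter i f x = iter j f x].
  pose g (i : 'I_#|T|.+1) := iter i f x.
  have /injectivePn[i [j neij eqg]] : ~~ injectiveb g.
    apply/negP => /injectiveP /leq_card; by rewrite card_ord ltnn.
  have ltT (l : 'I_#|T|.+1) : l <= #|T| by rewrite -ltnS.
  case: (ltngtP i j) => [lt|lt|/val_inj eq]; last by rewrite eq eqxx in neij.
    by exists i, j.
  by exists j, i.
have period n : iter (i + n * (j - i)) f x = iter i f x.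
  elim: n => [|n IHn]; first by rewrite addn0.
  rewrite mulSn addnA (subnKC (ltnW ltij)).
  by rewrite addnC iterD -eqij -iterD addnC.
have /dvdnP[q defN] : j - i %| #|T|`!.
  by apply: dvdn_fact; rewrite subn_gt0 ltij (leq_trans (leq_subr _ _)).
have leiN : i <= #|T|`!.
  apply: leq_trans (ltnW ltij) (leq_trans lejT (dvdn_leq (fact_gt0 _) _)).
  by rewrite dvdn_fact // leqnn (leq_trans _ lejT) // (leq_ltn_trans _ ltij).
by rewrite -{1 3}(subnK leiN) !iterD -(iterD i) {2}defN period.
Qed.

Lemma iter_fact_id (T : finType) (f : T -> T) (U : T -> Prop) :
    (forall x, U x -> U (f x)) ->
    (forall x y, U x -> U y -> f x = f y -> x = y) ->
  forall x, U x -> iter #|T|`! f x = x.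
Proof.
move=> fU finj x Ux.
have iterU n y : U y -> U (iter n f y) by move=> Uy; elim: n => //= n /fU.
have iter_inj n y y' : U y -> U y' -> iter n f y = iter n f y' -> y = y'.
  move=> Uy Uy'; elim: n => //= n IHn /finj eqn.
  by apply: IHn; apply: eqn; apply: iterU.
by apply: (iter_inj #|T|`!); [apply: iterU | | apply: iter_fact_idem].
Qed.

(** * Polynomial functions *)

Section Polynomials.
Variables (O : Type) (ar : O -> nat) (A : finType).
Variable op : forall f : O, ('I_(ar f) -> A) -> A.

(** Polynomials are handled as functions, so that substitution is composition; terms are rebuilt
    only through [pol_term]. *)
Inductive pol (V : Type) : ((V -> A) -> A) -> Prop :=
| pol_var v : pol (fun s => s v)
| pol_cst a : pol (fun=> a)
| pol_app f (g : 'I_(ar f) -> (V -> A) -> A) :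
    (forall i, pol (g i)) -> pol (fun s => op (fun i => g i s)).

Lemma pol_comp V W (F : (V -> A) -> A) (g : V -> (W -> A) -> A) :
  pol F -> (forall v, pol (g v)) -> pol (fun s => F (fun v => g v s)).
Proof.
move=> polF polg; elim: F / polF => [v|a|f h _ IH]; first exact: polg.
  exact: pol_cst.
exact: (pol_app IH).
Qed.

Lemma pol_poleval V (t : poly ar A V) : pol (fun s => poleval op s t).
Proof.
rewrite /poleval; elim: t => [v|a|f g IH] /=; [exact: pol_var|exact: pol_cst|].
exact: (pol_app IH).
Qed.

(** This serves both polynomial terms and constant-free terms in which extra variables carry the
    constants: [rho] and [kap] code variables and constants. *)
Lemma pol_term V (K X : Type) (k : K -> A) (sg : (V -> A) -> X -> A)
    (rho : V -> term ar K X) (kap : A -> term ar K X) (F : (V -> A) -> A) :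
    (forall s v, eval op k (sg s) (rho v) = s v) ->
    (forall s a, eval op k (sg s) (kap a) = a) ->
  pol F -> exists t, forall s, eval op k (sg s) t = F s.
Proof.
move=> rhoE kapE; elim=> [v|a|f g _ IH]; [by exists (rho v)|by exists (kap a)|].
have [t tE] := fin_all_exists IH.
exists (App t) => s /=; congr op.
by apply: functional_extensionality => i; apply: tE.
Qed.

(** Stating polynomiality as closure under substitution lets nested expressions be checked by mere
    application. *)
Definition pol1 (f : A -> A) :=
  forall V (g : (V -> A) -> A), pol g -> pol (fun s => f (g s)).
Definition pol2 (f : A -> A -> A) :=
  forall V (g h : (V -> A) -> A), pol g -> pol h -> pol (fun s => f (g s) (h s)).
Definition pol3 (f : A -> A -> A -> A) :=
  forall V (g h l : (V -> A) -> A), pol g -> pol h -> pol l ->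
    pol (fun s => f (g s) (h s) (l s)).

Lemma pol1_iter n f : pol1 f -> pol1 (iter n f).
Proof. by move=> polf V g polg; elim: n => //= n IHn; apply: polf. Qed.

Lemma pol2_iter n (f : A -> A -> A) : pol2 f -> pol2 (fun x => iter n (f x)).
Proof. by move=> polf V g h polg polh; elim: n => //= n IHn; apply: polf. Qed.

Lemma pol3_iter n (f : A -> A -> A -> A) :
  pol3 f -> pol3 (fun x y w => iter n (fun t => f t y w) x).
Proof. by move=> polf V g h l *; elim: n => //= n IHn; apply: polf. Qed.

(** * The left central series *)

Local Notation L := (left_series op).

Lemma left_seriesP i : congruence op (L i).
Proof.
elim: i => [|i _]; first by do !split.
split=> [x dl [rdl _] _ //|]; split=> [x y Lxy dl dlP|].
  by move=> dlC; have [_ [sdl _]] := dlP; apply: sdl (Lxy _ dlP dlC).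
split=> [x y w Lxy Lyw dl dlP dlC|f a b Lab dl dlP dlC].
  by have [_ [_ [tdl _]]] := dlP; apply: tdl (Lxy _ dlP dlC) (Lyw _ dlP dlC).
by have [_ [_ [_ cdl]]] := dlP; apply: cdl => j; apply: Lab.
Qed.

Lemma left_series_refl i x : L i x x.
Proof. by case: (left_seriesP i). Qed.

Lemma left_series_sym i x y : L i x y -> L i y x.
Proof. by have [_ [symL _]] := left_seriesP i; apply: symL. Qed.

Lemma left_series_trans i x y w : L i x y -> L i y w -> L i x w.
Proof. by have [_ [_ [trL _]]] := left_seriesP i; apply: trL. Qed.

Lemma left_series_pol1 i f x y : pol1 f -> L i x y -> L i (f x) (f y).
Proof.
move=> polf Lxy; have polF := polf unit _ (pol_var tt).
suff LF (F : (unit -> A) -> A) : pol F -> L i (F (fun=> x)) (F (fun=> y)).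
  exact: (LF _ polF).
elim=> // [a|g h _ IH]; first exact: left_series_refl.
by have [_ [_ [_ cL]]] := left_seriesP i; apply: cL.
Qed.

(** The term condition is inherited by intersections of congruences. *)
Lemma left_series_centralizes i :
  centralizes op (@cong1 A) (L i) (L i.+1).
Proof.
move=> m n t a b c d ab cd Lt dl dlP dlC.
by apply: dlC (Lt _ dlP dlC) => // j; apply: cd.
Qed.

(** This is the term condition for polynomials: each element of [A] becomes one more variable of the
    first block, with equal values on both sides. *)
Lemma left_series_shift i (W : finType) (f : (W -> A) -> A -> A) u u' c d :
    pol (fun s : option W -> A => f (fun w => s (Some w)) (s None)) ->
    L i c d ->
  L i.+1 (f u c) (f u d) -> L i.+1 (f u' c) (f u' d).
Proof.
move=> polf Lcd.
pose X := ('I_#|{: W + A}| + 'I_1)%type.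
pose par (v : W -> A) (j : 'I_#|{: W + A}|) :=
  match enum_val j with inl w => v w | inr a => a end.
pose sg (s : option W -> A) (x : X) :=
  match x with inl j => par (fun w => s (Some w)) j | inr j => s None end.
pose rho (v : option W) : pterm ar X :=
  Var _ _ (match v with Some w => inl (enum_rank (inl w)) | None => inr ord0 end).
pose kap (a : A) : pterm ar X := Var _ _ (inl (enum_rank (inr a))).
have [||t tE] := @pol_term _ _ _ (fun e : Empty_set => match e with end) sg rho kap
   _ _ _ polf.
- by move=> s [w|] //=; rewrite /par enum_rankK.
- by move=> s a /=; rewrite /par enum_rankK.
have tE2 v x : f v x =
    peval op (fun y => match y with inl j => par v j | inr j => (fun=> x) j end) t.
  by rewrite -[LHS](tE (fun o => if o is Some w then v w else x)).
rewrite !tE2; exact: left_series_centralizes.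
Qed.

Lemma left_series_shift2 i (f : A -> A -> A) u u' c d :
  pol2 f -> L i c d -> L i.+1 (f u c) (f u d) -> L i.+1 (f u' c) (f u' d).
Proof.
move=> polf; apply: (@left_series_shift i unit (fun v => f (v tt)) (fun=> u) (fun=> u')).
by apply: polf; apply: pol_var.
Qed.

(** * Iterating a polynomial in itself *)

Definition row V (S : pred V) (x z : A) : V -> A := fun v => if S v then x else z.

(** Position [(v, w)] carries x when both coordinates do. If [v] lies outside the row, its inner
    copy of [F'] sees only [z] and returns [z], so rows compose. *)
Lemma star_power V (F : (V -> A) -> A) (S : nat -> pred V) z n :
    pol F -> F (fun=> z) = z ->
  exists W (F' : (W -> A) -> A) (S' : nat -> pred W),
    [/\ pol F', F' (fun=> z) = z, forall s, exists s', F' s = F s',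
        forall i x, F' (row (S' i) x z) = iter n.+1 (fun y => F (row (S i) y z)) x
      & forall w, exists v, forall i, ~~ S i v -> ~~ S' i w].
Proof.
move=> polF Fz; elim: n => [|n [W [F' [S' [polF' F'z _ rowF' supS']]]]].
  exists V, F, S; split=> // [s|v]; [by exists s | by exists v].
exists (V * W)%type, (fun s => F (fun v => F' (fun w => s (v, w)))).
exists (fun i vw => S i vw.1 && S' i vw.2); split.
- apply: pol_comp polF _ => v.
  by apply: (pol_comp (g := fun w s => s (v, w))) => // w; apply: pol_var.
- by rewrite F'z.
- by move=> s; exists (fun v => F' (fun w => s (v, w))).
- move=> i x; rewrite iterS -rowF'; congr F; apply: functional_extensionality => v.
  by rewrite {2}/row /=; case Sv: (S i v); rewrite -?[RHS]F'z; congr F';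
    apply: functional_extensionality => w; rewrite /row /= Sv.
- by move=> [v w]; exists v => i /negPf /= ->.
Qed.

(** * From rows to a quasigroup polynomial *)

Section LeftNilpotent.
Variable nlen : nat.
Hypothesis left_series_end : forall x y, L nlen x y -> x = y.

Lemma left_series_ind x y : (forall i, L i x y -> L i.+1 x y) -> x = y.
Proof. by move=> step; apply: left_series_end; elim: nlen => // i /step. Qed.

Local Notation N := #|A|`!.

(** The pair [x], [x'] descends along the series: from [L i] for it one gets [L i.+1] first for [q],
    [q'], then for [e x], [e x'], and finally for [x], [x']. *)
Lemma glue_inj (U : A -> Prop) (z : A) (G : A -> A -> A -> A) (Q : A -> A -> A) :
    pol3 G -> pol2 Q ->
    (forall x y w, G (G x y w) y w = G x y w) ->
    (forall x, U x -> G x x z = x) ->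
    (forall x y, G (Q x y) z z = Q x y) ->
    (forall b x y, G x z z = x -> G y z z = y -> G b z z = b ->
       Q x b = Q y b -> x = y) ->
  forall b x x', U x -> U x' ->
    G (Q (G x z z) (G b z z)) x b = G (Q (G x' z z) (G b z z)) x' b -> x = x'.
Proof.
move=> polG polQ Gid Gx QU Qinj b x x' Ux Ux'.
pose e t := G t z z; rewrite -/(e x) -/(e x') -/(e b).
set q := Q (e x) _; set q' := Q (e x') _ => eqG.
have polz V : pol (fun _ : V -> A => z) by apply: pol_cst.
have pole : pol1 e by move=> V g polg; apply: polG.
apply: left_series_ind => i Lxx'.
(* By centrality [p = x] and [b = z] suffice; there [G x x z = x], while
   [t := G x x' z] satisfies [G t x' z = t = G x x' z]. *)
have eG_indep p : L i.+1 (e (G p x b)) (e (G p x' b)).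
  have polf p0 : pol2 (fun u y => e (G p0 y u)).
    by move=> V g h *; apply: pole; apply: polG => //; apply: pol_cst.
  have polf' w : pol2 (fun u y => e (G u y w)).
    by move=> V g h *; apply: pole; apply: polG => //; apply: pol_cst.
  apply: (left_series_shift2 (f := fun u y => e (G p y u)) (u := z)) => //.
  apply: (left_series_shift2 (f := fun u y => e (G u y z)) (u := x)) => //.
  rewrite Gx //; set t := G x x' z; apply: left_series_sym.
  apply: (left_series_shift2 (f := fun u y => G y u z) (u := x')).
  - by move=> V g h *; apply: polG.
  - rewrite -[X in L i _ X](Gx x) // /t.
    apply: (left_series_pol1 (f := fun y => G x y z)); last exact: left_series_sym.
    by move=> V g *; apply: polG => //; apply: pol_cst.
  - by rewrite Gid; apply: left_series_refl.
have Lex : L i (e x) (e x') by apply: left_series_pol1.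
have polQb : pol1 (Q^~ (e b)).
  by move=> V g polg; apply: (polQ V g (fun=> e b)) => //; apply: pol_cst.
have Lq : L i q q' by apply: (left_series_pol1 polQb).
(* Since [q = e (G q z z)], centrality allows the last arguments to be [x] and [b]; there [eqG]
   reduces the claim to [eG_indep] at [q']. *)
have Lq1 : L i.+1 q q'.
  have eq_q : e q = q := QU _ _; have eq_q' : e q' = q' := QU _ _.
  have eGq p : e p = p -> p = e (G p z z) by move=> ep; rewrite -[G p z z]/(e p) !ep.
  rewrite (eGq q) // (eGq q') //.
  apply: (left_series_shift2 (f := fun u t => e (G t u z)) (u := x)) => //.
    by move=> V g h *; apply: pole; apply: polG.
  apply: (left_series_shift2 (f := fun u t => e (G t x u)) (u := b)) => //.
    by move=> V g h *; apply: pole; apply: polG => //; apply: pol_cst.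
  rewrite eqG; apply: left_series_sym; exact: eG_indep.
have Lex1 : L i.+1 (e x) (e x').
  (* On the range of [e] the translation by [e b] is a permutation, inverted by its iterate of order
     [N.-1], a polynomial. *)
  have QK t : e t = t -> iter N (Q^~ (e b)) t = t.
    apply: (iter_fact_id (U := fun t => e t = t)) t; first by move=> y _; apply: QU.
    by move=> y y' ey ey'; apply: Qinj => //; apply: Gid.
  have QKe t : iter N.-1 (Q^~ (e b)) (Q (e t) (e b)) = e t.
    by rewrite -[RHS](QK (e t)) ?[e (e t)]Gid // -[in RHS](prednK (fact_gt0 #|A|)) iterSr.
  rewrite -(QKe x) -(QKe x').
  by apply: left_series_pol1 => //; apply: pol1_iter.
(* The first half rests on [e x] and [e x']; the second compares middle arguments at outer arguments
   [q'] and [b], where [eqG] applies. *)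
apply: (@left_series_trans _ _ (G x' x z)).
  rewrite -[X in L _ X _](Gx x) //.
  apply: (left_series_shift2 (f := fun u t => G t u z) (u := z)) => //.
  by move=> V g h *; apply: polG.
rewrite -[X in L _ _ X](Gx x') //.
apply: (left_series_shift2 (f := fun u y => G u y z) (u := q')) => //.
  by move=> V g h *; apply: polG.
apply: (left_series_shift2 (f := fun u y => G q' y u) (u := b)) => //.
  by move=> V g h *; apply: polG => //; apply: pol_cst.
rewrite -eqG; apply: (left_series_pol1 (f := fun t => G t x b)).
  by move=> V g *; apply: polG => //; apply: pol_cst.
exact: left_series_sym.
Qed.


(** The range of the idempotent is described by the equation [e x = x], so that the induction can
    pass to the range of [e'] inside it. *)
Lemma quasigroup_of_rows k (e : A -> A) z V (F : (V -> A) -> A) (S : nat -> pred V) :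
    pol F -> (forall s, e (F s) = F s) -> F (fun=> z) = z ->
    (forall i x y, i <= k -> e x = x -> e y = y ->
       F (row (S i) x z) = F (row (S i) y z) -> x = y) ->
    (forall v, exists2 i, i <= k & ~~ S i v) ->
  exists Q, [/\ pol2 Q, forall x y, e (Q x y) = Q x y,
    forall b x y, e x = x -> e y = y -> e b = b -> Q x b = Q y b -> x = y
    & forall b x y, e x = x -> e y = y -> e b = b -> Q b x = Q b y -> x = y].
Proof.
elim: k e V F S => [|k IHk] e V F S polF eF Fz rowF supS.
  (* With a single row no position carries x: this row is constant and injective, so [e] has at most
     one fixed point. *)
  have U1 x y : e x = x -> e y = y -> x = y.
    move=> ex ey; apply: (rowF 0) => //; congr F.
    apply: functional_extensionality => v; rewrite /row.
    by have [i] := supS v; rewrite leqn0 => /eqP-> /negPf->.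
  exists (fun _ _ => z); split=> // [? ? ? *|x y|b x y *|b x y *]; try exact: U1.
  - exact: pol_cst.
  by rewrite -{2}Fz -eF Fz.
have [W [F1 [S1 [polF1 F1z F1F rowF1 supS1]]]] := star_power S N.-1 polF Fz.
have eF1 s : e (F1 s) = F1 s by have [s' ->] := F1F s; apply: eF.
have {}rowF1 i x : i <= k.+1 -> e x = x -> F1 (row (S1 i) x z) = x.
  move=> lik ex; rewrite rowF1 prednK ?fact_gt0 //.
  apply: (iter_fact_id (U := fun y => e y = y)) => // a b ea eb; exact: rowF lik ea eb.
have {}supS1 w : exists2 i, i <= k.+1 & ~~ S1 i w.
  have [v sub] := supS1 w; have [i lik] := supS v; exists i => //; exact: sub.
pose T := predI (S1 0) (S1 1).
pose K x y w :=
  F1 (fun v => if S1 0 v then if S1 1 v then x else y else if S1 1 v then w else z).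
have polK : pol3 K.
  move=> X g h l polg polh poll.
  apply: (pol_comp (g := fun v s => if S1 0 v then if S1 1 v then g s else h s
                                    else if S1 1 v then l s else z)) => // v.
  by case: (S1 0 v); case: (S1 1 v) => //; apply: pol_cst.
have KxxE x : e x = x -> K x x z = x.
  move=> ex; rewrite -[RHS](rowF1 0) //; congr F1.
  by apply: functional_extensionality => v; rewrite /row; do 2!case: ifP.
have KxzE x : e x = x -> K x z x = x.
  move=> ex; rewrite -[RHS](rowF1 1) //; congr F1.
  by apply: functional_extensionality => v; rewrite /row; do 2!case: ifP.
have KTE x : K x z z = F1 (row T x z).
  by congr F1; apply: functional_extensionality => v; rewrite /row /=; do 2!case: ifP.
pose G x y w := iter N (fun t => K t y w) x.
have polG : pol3 G by apply: pol3_iter.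
have Gid x y w : G (G x y w) y w = G x y w by apply: iter_fact_idem.
have GxxE x : e x = x -> G x x z = x by move=> ex; apply: iter_fix; apply: KxxE.
have GxzE x : e x = x -> G x z x = x by move=> ex; apply: iter_fix; apply: KxzE.
have eG x y w : e (G x y w) = G x y w.
  by rewrite /G -(prednK (fact_gt0 _)) iterS eF1.
pose e' x := G x z z.
have e'e x : e' x = x -> e x = x by move=> <-; apply: eG.
have Kzz : K z z z = z by rewrite KxxE // -F1z eF1.
(* The merged row [T] replaces rows 0 and 1, and [e'] brings the values of [F1] into its range. *)
have [||||| Q [polQ e'Q Qinjl Qinjr]] := IHk e' W (fun s => e' (F1 s))
    (fun i => if i is j.+1 then S1 j.+2 else T).
- by move=> *; apply: polG => //; apply: pol_cst.
- by move=> s; apply: Gid.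
- by rewrite F1z /e' /G iter_fix.
- move=> [|i] x y lik e'x e'y.
    (* [K] at [z], [z] preserves the range of its iterate [e'], and is injective there because [e']
       is the identity on it. *)
    have e'K t : e' t = t -> e' (K t z z) = K t z z.
      by rewrite /e' /G -iterSr iterS => ->.
    have e'E t : e' t = iter N.-1 (fun u => K u z z) (K t z z).
      by rewrite -iterSr prednK ?fact_gt0.
    by rewrite -!KTE !e'K // => eqK; rewrite -e'x -e'y !e'E eqK.
  by rewrite !rowF1 ?e'x ?e'y //; apply: e'e.
- move=> w; have [[|[|i]] lik Si] := supS1 w.
  + by exists 0; rewrite //= (negPf Si).
  + by exists 0; rewrite //= (negPf Si) andbF.
  + by exists i.+1.
exists (fun x y => G (Q (e' x) (e' y)) x y); split=> //.
- move=> X g h polg polh; apply: (polG) => //.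
  by apply: polQ; apply: polG => //; apply: pol_cst.
- by move=> b x y ex ey _; apply: (@glue_inj (fun t => e t = t) z G Q).
(* The other translations follow by exchanging the last two arguments of [G] and the two of [Q]. *)
move=> b x y ex ey _.
apply: (@glue_inj (fun t => e t = t) z (fun t u v => G t v u) (fun t u => Q u t)) => //.
- by move=> X g h l *; apply: polG.
- by move=> X g h *; apply: polQ.
by move=> t u; apply: e'Q.
Qed.

End LeftNilpotent.

(** * From a quasigroup polynomial to a Maltsev polynomial *)

(** Translations are permutations of a finite set, so both divisions are iterates of translations,
    hence polynomials. *)
Lemma maltsev_of_quasigroup (Q : A -> A -> A) : pol2 Q ->
    (forall b x y, Q x b = Q y b -> x = y) ->
    (forall b x y, Q b x = Q b y -> x = y) ->
  has_maltsev_poly op.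
Proof.
move=> polQ Qinjl Qinjr.
pose ldiv a c := iter #|A|`!.-1 (Q a) c.
pose rdiv c b := iter #|A|`!.-1 (Q^~ b) c.
have ldivK a c : Q a (ldiv a c) = c.
  rewrite -iterS prednK ?fact_gt0 //.
  by apply: (iter_fact_id (U := fun=> True)) => // x y _ _; apply: Qinjr.
have rdivK c b : Q (rdiv c b) b = c.
  rewrite -[LHS]/(iter _.+1 (Q^~ b) c) prednK ?fact_gt0 //.
  by apply: (iter_fact_id (U := fun=> True)) => // x y _ _; apply: Qinjl.
have polld : pol2 ldiv by apply: pol2_iter.
have polrd : pol2 rdiv.
  move=> V g h polg polh; rewrite /rdiv; elim: _.-1 => //= n IHn; exact: polQ.
pose m (s : 'I_3 -> A) :=
  Q (rdiv (s (inord 0)) (ldiv (s (inord 1)) (s (inord 1))))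
    (ldiv (s (inord 1)) (s (inord 2))).
have polm : pol m.
  by rewrite /m; apply: polQ; [apply: polrd|]; rewrite ?/ldiv;
    try apply: polld; apply: pol_var.
have [//|//|t tE] := @pol_term _ A 'I_3 id (fun s => s) (fun i => Var _ _ i)
  (fun a => Cst _ _ a) _ _ _ polm.
exists t => x y; rewrite /poleval !tE /m !inordK //=; split; first by rewrite rdivK.
(* Both [y] and [rdiv y (ldiv y y)] give [y] when multiplied by [ldiv y y], so they agree. *)
by rewrite (Qinjl (ldiv y y) (rdiv y (ldiv y y)) y) ?rdivK ?ldivK.
Qed.

End Polynomials.


(** * The equivalence *)

Theorem theorem6p1 (O : Type) (ar : O -> nat) (A : finType)
    (op : forall f : O, ('I_(ar f) -> A) -> A) :
  left_nilpotent op ->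
  (has_maltsev_poly op <-> has_pointed_cube_poly op).
Proof.
move=> [n endL]; split=> [[m mP]|[p [k [m [c [F [M [k_gt0 [_ [_ [supM rowM]]]]]]]]]]].
  (* The Maltsev identities have rows x, y, y and y, y, x, with x coded as 0 and y as 1; every
     column contains y. *)
  exists 0, 2, 3, (fun i : 'I_0 => match notF (ltn_ord i) with end), m.
  exists (fun i j => inl (nth 0 (nth [::] [:: [:: 0; 1; 1]; [:: 1; 1; 0]] i) j)).
  split=> //; split=> //; split; first by move=> [].
  split=> [[[|[|[|j]]] ltj] //|i s].
  - by exists (Ordinal (isT : 1 < 2)).
  - by exists (Ordinal (isT : 0 < 2)).
  - by exists (Ordinal (isT : 0 < 2)).
  have [m1 m2] := mP (s 0) (s 1).
  case: i => [[|[|i]] lti] //.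
    rewrite -[RHS]m1; congr poleval; apply: functional_extensionality.
    by case=> [[|[|[|j]]] ltj].
  rewrite -[RHS]m2; congr poleval; apply: functional_extensionality.
  by case=> [[|[|[|j]]] ltj].
(* On an empty algebra the Maltsev identities hold vacuously. *)
have [z _|A0] := pickP A; last first.
  by exists (Var _ _ ord0) => x; have := A0 x.
case: k k_gt0 M supM rowM => // k _ M supM rowM.
pose S (i : nat) : pred 'I_m := fun j => M (inord i) j == inl 0.
pose f := fun s => poleval op s F; have polf : pol op f := pol_poleval op F.
have rowf i x y : f (row (S i) x z) = f (row (S i) y z) -> x = y.
  pose g (u : 'I_m -> A) t := f (fun j => if S i j then t else u j).
  (* With the original constants as parameters the row is the identity; moving all parameters to [z]
     keeps it injective. *)
  pose u j := match M (inord i) j with inl _ => z | inr q => c q end.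
  have gK t : g u t = t.
    rewrite -[RHS](rowM (inord i) (fun v => if v == 0 then t else z)) /g /f.
    congr poleval; apply: functional_extensionality => j; rewrite /S /u.
    by case: (M _ j) => // -[].
  move=> eqf; apply: (left_series_ind endL) => l Lxy.
  rewrite -(gK x) -(gK y); apply: (@left_series_shift _ _ _ _ _ _ g (fun=> z)) => //.
    apply: (pol_comp (g := fun j s => if S i j then s None else s (Some j))) => // j.
    by case: (S i j); apply: pol_var.
  by rewrite /g -!/(row _ _ _) eqf; apply: left_series_refl.
(* Any row would do: [pi z] is the value of [f] at constant [z], so composing [f] with the inverse
   of [pi] makes [z] idempotent. *)
pose pi x := f (row (S 0) x z).
have piK x : iter #|A|`!.-1 pi (pi x) = x.
  rewrite -iterSr prednK ?fact_gt0 //.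
  by apply: (iter_fact_id (U := fun=> True)) => // y w _ _; apply: rowf.
pose f1 s := iter #|A|`!.-1 pi (f s).
have pi_pol : pol1 op pi.
  move=> V g polg; apply: (pol_comp (g := fun j s => if S 0 j then g s else z)) => // j.
  by case: (S 0 j) => //; apply: pol_cst.
have iter_inj l : injective (iter l pi).
  by elim: l => //= l IHl x y /rowf /IHl.
have [|||||Q [polQ _ Qinjl Qinjr]] :=
    @quasigroup_of_rows _ _ _ _ _ endL k id z _ f1 S.
- exact: pol1_iter.
- by [].
- rewrite -[RHS]piK /f1 /pi; congr (iter _ _ (f _)).
  by apply: functional_extensionality => j; rewrite /row; case: ifP.
- by move=> i x y _ _ _ /iter_inj /rowf.
- move=> j; have [i Mij] := supM j; exists i; first by rewrite -ltnS.
  by rewrite /S inord_val; apply/eqP.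
by apply: (maltsev_of_quasigroup polQ) => b x y; [apply: Qinjl|apply: Qinjr].
Qed.
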